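(* Consider an $n$-qubit all-to-all random circuit of depth $D>1$ subject to noise generated by a replacement channel with rate parameter $0<\gamma\le1$. Let $\rho$ and $\sigma$ be two orthogonal pure $n$-qubit states. Then $$\frac12\,\mathbb E\,\|\mathcal C(\rho-\sigma)\|_1\ \le\ O\!\left(2^{n/2}\left(1-\frac{\gamma}{2}\right)^{n(D-1)/2}\right),$$ where $\mathcal C$ denotes the channel corresponding to the noisy random circuit and $\mathbb E$ denotes the expectation over the gate unitaries.
   Context: **Replacement channel.** For $0<\gamma\le 1$ and a fixed single-qubit state $\sigma^*$, the replacement channel is $\mathcal N(\rho)=(1-\gamma)\rho+\gamma\sigma^*$ for every single-qubit density matrix $\rho$ (extended linearly). **All-to-all random circuit.** Each of the $D$ layers consists of a global $n$-qubit unitary gate, drawn independently from the Haar measure on the unitary group of $(\mathbb C^2)^{\otimes n}$, followed by the single-qubit noise channel $\mathcal N$ on every qubit: $$\mathcal C=\mathcal N^{\otimes n}\circ\mathcal U_D\circ\cdots\circ\mathcal N^{\otimes n}\circ\mathcal U_1,\qquad \mathcal U_k(X)=U_kXU_k^\dagger .$$ The $O(\cdot)$ is asymptotic for large $n$, with an implied constant not depending on $n$. $\|\cdot\|_1$ is the trace norm. *)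

(* Defs.v *)
From HB Require Import structures.
From mathcomp Require Import all_boot all_order all_algebra.
From mathcomp Require Import all_classical all_reals all_analysis.
From mathcomp Require Import complex.

Set Implicit Arguments.
Unset Strict Implicit.
Unset Printing Implicit Defensive.

Import Order.TTheory GRing.Theory Num.Theory.
Import numFieldNormedType.Exports.

Local Open Scope classical_set_scope.
Local Open Scope ring_scope.
Local Open Scope complex_scope.
Local Open Scope sesquilinear_scope.

Section Matrices.
Variable R : realType.
Local Notation C := R[i].

(* Functional calculus on the unitary diagonalization; meaningful for
   positive semidefinite [A]. *)
Definition psd_sqrt (N : nat) (A : 'M[C]_N) : 'M[C]_N :=
  invmx (spectralmx A) *m diag_mx (map_mx sqrtC (spectral_diag A))
    *m spectralmx A.

Definition trace_norm (N : nat) (A : 'M[C]_N) : R :=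
  complex.Re (\tr (psd_sqrt (A^t* *m A))).

Definition is_density (N : nat) (rho : 'M[C]_N) : Prop :=
  [/\ rho \is hermsymmx,
      forall v : 'cV[C]_N, 0 <= (v^t* *m rho *m v) 0 0
    & \tr rho = 1].

Definition is_unit_vector (N : nat) (psi : 'cV[C]_N) : Prop :=
  psi^t* *m psi = 1%:M.

Definition pure_state (N : nat) (psi : 'cV[C]_N) : 'M[C]_N := psi *m psi^t*.

End Matrices.

Section Qubits.
Variable R : realType.
Local Notation C := R[i].

(* Matrix indices on n qubits enumerate the computational basis, that is the
   bit strings [{ffun 'I_n -> 'I_2}]; [qdim n] is 2 ^ n by [qdimE]. *)
Definition qdim (n : nat) : nat := #|{ffun 'I_n -> 'I_2}|.

Lemma qdimE (n : nat) : qdim n = (2 ^ n)%N.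
Proof. by rewrite /qdim card_ffun !card_ord. Qed.

Definition bits (n : nat) (i : 'I_(qdim n)) : {ffun 'I_n -> 'I_2} := enum_val i.

Definition tensor_mx (n : nat) (A : 'I_n -> 'M[C]_2) : 'M[C]_(qdim n) :=
  \matrix_(i, j) \prod_q A q (bits i q) (bits j q).

(* The n-fold tensor power of a linear map [Phi]: the linear extension of
   (x)_q |a_q><b_q|  |->  (x)_q Phi(|a_q><b_q|). *)
Definition tensor_channel (n : nat) (Phi : 'M[C]_2 -> 'M[C]_2)
    (X : 'M[C]_(qdim n)) : 'M[C]_(qdim n) :=
  \sum_i \sum_j
    X i j *: tensor_mx (fun q => Phi (delta_mx (bits i q) (bits j q))).

(* The trace factor is the linear extension from density matrices. *)
Definition replacement_channel (gamma : R) (sigma X : 'M[C]_2) : 'M[C]_2 :=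
  (1 - gamma)%:C *: X + (gamma%:C * \tr X) *: sigma.

(* The gates are listed in the order in which they are applied. *)
Definition noisy_circuit (n : nat) (Phi : 'M[C]_2 -> 'M[C]_2)
    (gates : seq 'M[C]_(qdim n)) (X : 'M[C]_(qdim n)) : 'M[C]_(qdim n) :=
  foldl (fun Y U => tensor_channel Phi (U *m Y *m U^t*)) X gates.

End Qubits.

Section UnitaryGroup.
Variables (R : realType) (N : nat).
Local Notation C := R[i].

Record unitary_group := Unitary {
  umx :> 'M[C]_N;
  umx_unitary : umx \is unitarymx
}.

HB.instance Definition _ := [isSub of unitary_group for umx].
HB.instance Definition _ := [Choice of unitary_group by <:].

Lemma one_is_unitary : (1%:M : 'M[C]_N) \is unitarymx.
Proof. by apply/unitarymxP; rewrite trmx1 map_mx1 mul1mx. Qed.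

HB.instance Definition _ := isPointed.Build unitary_group (Unitary one_is_unitary).

Definition umul (U V : unitary_group) : unitary_group :=
  Unitary (mul_unitarymx (umx_unitary U) (umx_unitary V)).

(* [R[i]] carries its topology through its [numFieldType] structure. *)
Definition unitary_open : set (set unitary_group) :=
  [set umx @^-1` O | O in @open 'M[C : numFieldType]_N].

End UnitaryGroup.

Notation borel_unitary R N := (g_sigma_algebraType (@unitary_open R N)).

(* The Haar probability measure is the unique left-invariant Borel probability
   measure on the (compact) group. *)
Definition is_haar (R : realType) (N : nat)
    (mu : probability (borel_unitary R N) R) : Prop :=
  forall (V : unitary_group R N) (A : set (borel_unitary R N)), measurable A ->
    mu (umul V @^-1` A) = mu A.

Definition mutually_independent d (T : measurableType d) (R : realType)
    (P : probability T R) (I : finType) d' (T' : measurableType d')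
    (X : I -> {RV P >-> T'}) : Prop :=
  forall (J : {set I}) (A : I -> set T'), (forall k, measurable (A k)) ->
    P (\bigcap_(k in [set` J]) (X k @^-1` A k)) =
    (\prod_(k in J) P (X k @^-1` A k))%E.

(* Main.v *)
(* The trace norm of an [N x N] matrix is at most [sqrt N] times its
   Hilbert-Schmidt norm, so it suffices to bound the expected squared
   Hilbert-Schmidt norm [s] of the difference of the two outputs.  If [X] is
   traceless and [U] is Haar distributed, left invariance under diagonal
   phases, permutations and one reflection determines the second moments of
   [U X U^*].  Writing [Phi] for the replacement channel and [Phi^n] for its
   n-fold tensor power, a layer therefore multiplies [s] by
   [(f ^ n - ||Phi^n(1)||^2 / N) / (N ^ 2 - 1)], where
   [f = \sum_xy ||Phi(|x><y|)||^2 <= 4 (1 - gamma / 2)], and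
   [||Phi^n(1)||^2 >= N] because the channel preserves the trace.  Hence each
   layer contracts [s] by [(1 - gamma / 2) ^ n], uniformly in the depth.
   Independence is only used through the invariance of the joint law of the
   gates under left multiplication of a single gate. *)

Require Import Defs.
From mathcomp Require Import all_boot all_order all_algebra.
From mathcomp Require Import all_classical all_reals all_analysis.
From mathcomp Require Import complex fingroup perm measurable_realfun ring lra.
Import Order.TTheory GRing.Theory Num.Theory.
Import numFieldNormedType.Exports.
Local Open Scope classical_set_scope.
Local Open Scope ring_scope.
Local Open Scope sesquilinear_scope.

Set Implicit Arguments.
Unset Strict Implicit.
Unset Printing Implicit Defensive.

(** * Expectation of bounded complex random variables *)

Section ComplexExpectation.
Context {d : measure_display} {T : measurableType d} {R : realType}.
Variable P : probability T R.
Local Notation C := R[i].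
Implicit Types f g : T -> C.

(** Boundedness gives integrability on a probability space and, unlike integrability, survives
    products, so every polynomial in the gate entries and their conjugates qualifies. *)
Definition bounded_measurable f : Prop :=
  [/\ measurable_fun setT (fun x => complex.Re (f x)),
      measurable_fun setT (fun x => complex.Im (f x)) &
      exists M : R, forall x,
        `|complex.Re (f x)| <= M /\ `|complex.Im (f x)| <= M].

Definition cexpect f : C :=
  ((\int[P]_x complex.Re (f x)) +i* (\int[P]_x complex.Im (f x)))%C.

Lemma bounded_measurable_cst (c : C) : bounded_measurable (fun=> c).
Proof.
split; [exact: measurable_cst..|].
exists (Num.max `|complex.Re c| `|complex.Im c|) => x.
by rewrite !le_max !lexx orbT.
Qed.

Lemma bounded_measurableD f g : bounded_measurable f ->
  bounded_measurable g -> bounded_measurable (fun x => f x + g x).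
Proof.
move=> [f1 f2 [M Mf]] [g1 g2 [L Lg]]; split.
- under eq_fun do rewrite raddfD; exact: measurable_funD.
- under eq_fun do rewrite raddfD; exact: measurable_funD.
- exists (M + L) => x; rewrite !raddfD /=.
  have [? ?] := Mf x; have [? ?] := Lg x.
  by split; apply: (le_trans (ler_normD _ _)); apply: lerD.
Qed.

Lemma bounded_measurableM f g : bounded_measurable f ->
  bounded_measurable g -> bounded_measurable (fun x => f x * g x).
Proof.
move=> [f1 f2 [M Mf]] [g1 g2 [L Lg]].
have ReM (a b : C) : complex.Re (a * b) =
    complex.Re a * complex.Re b - complex.Im a * complex.Im b.
  by case: a b => [? ?] [].
have ImM (a b : C) : complex.Im (a * b) =
    complex.Re a * complex.Im b + complex.Im a * complex.Re b.
  by case: a b => [? ?] [].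
split.
- under eq_fun do rewrite ReM.
  by apply: measurable_funB; apply: measurable_funM.
- under eq_fun do rewrite ImM.
  by apply: measurable_funD; apply: measurable_funM.
- exists (M * L + M * L) => x; rewrite ReM ImM.
  have [? ?] := Mf x; have [? ?] := Lg x.
  by split; [apply: (le_trans (ler_normB _ _)) | apply: (le_trans (ler_normD _ _))];
    apply: lerD; rewrite normrM; apply: ler_pM.
Qed.

Lemma bounded_measurable_conj f :
  bounded_measurable f -> bounded_measurable (fun x => (f x)^*).
Proof.
have ReJ (a : C) : complex.Re a^* = complex.Re a by case: a.
have ImJ (a : C) : complex.Im a^* = - complex.Im a by case: a.
move=> [f1 f2 [M Mf]]; split.
- by under eq_fun do rewrite ReJ.
- by under eq_fun do rewrite ImJ; exact: measurableT_comp.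
- by exists M => x; rewrite ReJ ImJ normrN.
Qed.

Lemma bounded_measurable_sum (I : Type) (r : seq I) (p : pred I)
    (f : I -> T -> C) : (forall i, bounded_measurable (f i)) ->
  bounded_measurable (fun x => \sum_(i <- r | p i) f i x).
Proof.
move=> mf; elim: r => [|i r IH].
  under eq_fun do rewrite big_nil; exact: bounded_measurable_cst.
under eq_fun do rewrite big_cons.
by case: (p i) => //; exact: bounded_measurableD.
Qed.

Lemma bounded_integrable (f : T -> R) : measurable_fun setT f ->
  (exists M : R, forall x, `|f x| <= M) -> P.-integrable setT (EFin \o f).
Proof.
move=> mf [M Mf].
apply: measurable_bounded_integrable => //.
  by rewrite (le_lt_trans (probability_le1 _ _))// ltry.
exists M; split; first exact: num_real.
by move=> x Mx y _; exact: le_trans (Mf y) (ltW Mx).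
Qed.

Lemma bounded_measurable_integrable f : bounded_measurable f ->
  P.-integrable setT (EFin \o (fun x => complex.Re (f x))) /\
  P.-integrable setT (EFin \o (fun x => complex.Im (f x))).
Proof.
move=> [f1 f2 [M Mf]].
by split; apply: bounded_integrable => //; exists M => x; case: (Mf x).
Qed.

Lemma cexpectD f g : bounded_measurable f -> bounded_measurable g ->
  cexpect (fun x => f x + g x) = cexpect f + cexpect g.
Proof.
move=> /bounded_measurable_integrable[f1 f2].
move=> /bounded_measurable_integrable[g1 g2].
rewrite /cexpect.
under eq_Rintegral do rewrite raddfD /=.
rewrite RintegralD//.
under [X in (_ +i* X)%C = _]eq_Rintegral do rewrite raddfD /=.
by rewrite RintegralD.
Qed.

Lemma cexpectZ (c : C) f : bounded_measurable f ->
  cexpect (fun x => c * f x) = c * cexpect f.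
Proof.
move=> /bounded_measurable_integrable[f1 f2].
have iZ (a : R) (h : T -> R) : P.-integrable setT (EFin \o h) ->
    P.-integrable setT (EFin \o (fun x => a * h x)).
  move=> ih; have := integrableZl measurableT a ih; apply: eq_integrable => //.
case: c => a b; rewrite /cexpect.
have E1 : \int[P]_x complex.Re ((a +i* b)%C * f x) =
    a * \int[P]_x complex.Re (f x) - b * \int[P]_x complex.Im (f x).
  rewrite -!RintegralZl// -RintegralB//; try exact: iZ.
  by apply: eq_Rintegral => x _; case: (f x).
have E2 : \int[P]_x complex.Im ((a +i* b)%C * f x) =
    a * \int[P]_x complex.Im (f x) + b * \int[P]_x complex.Re (f x).
  rewrite -!RintegralZl// -RintegralD//; try exact: iZ.
  by apply: eq_Rintegral => x _; case: (f x).
by rewrite E1 E2.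
Qed.

Lemma cexpect_cst (c : C) : cexpect (fun=> c) = c.
Proof.
case: c => a b; rewrite /cexpect !Rintegral_cst//.
have PT : (P : {measure set T -> \bar R}) setT = 1%E by exact: probability_setT.
by rewrite PT /= !mulr1.
Qed.

Lemma cexpect_sum (I : Type) (r : seq I) (p : pred I) (f : I -> T -> C) :
  (forall i, bounded_measurable (f i)) ->
  cexpect (fun x => \sum_(i <- r | p i) f i x) =
  \sum_(i <- r | p i) cexpect (f i).
Proof.
move=> mf; elim: r => [|i r IH].
  by rewrite big_nil; under eq_fun do rewrite big_nil; rewrite cexpect_cst.
rewrite big_cons; under eq_fun do rewrite big_cons.
case: (p i) => //; rewrite cexpectD ?IH//; exact: bounded_measurable_sum.
Qed.

Lemma cexpect_ge0 (f : T -> C) : (forall x, 0 <= f x) -> 0 <= cexpect f.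
Proof.
move=> f0; have f0' x : complex.Im (f x) = 0 /\ 0 <= complex.Re (f x).
  by have := f0 x; case: (f x) => a b; rewrite lecE /= => /andP[/eqP -> ->].
rewrite lecE /=; apply/andP; split.
  rewrite (@eq_Rintegral _ _ _ P _ (fun=> 0)) ?Rintegral_cst ?mul0r// => x _.
  by case: (f0' x).
by apply: Rintegral_ge0 => x _; case: (f0' x).
Qed.

(** The integral of a nonnegative function is a supremum over the simple functions below it, hence
    monotone. This compares the trace norm with a measurable majorant directly. *)
Lemma ge0_le_integral_nonmeasurable (f g : T -> \bar R) :
  (forall x, 0 <= f x)%E -> (forall x, f x <= g x)%E ->
  (\int[P]_x f x <= \int[P]_x g x)%E.
Proof.
move=> f0 fg; have g0 x : (0 <= g x)%E by exact: le_trans (fg x).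
rewrite !ge0_integralTE//; apply: le_ereal_sup => _ [h hf <-].
by exists h => // x; exact: le_trans (hf x) (fg x).
Qed.

End ComplexExpectation.

(** * Joint law of independent Haar gates *)

Section BorelUnitary.
Context {R : realType} {N : nat}.
Local Notation C := R[i].
Local Notation UN := (borel_unitary R N).

(** The Lipschitz condition keeps [h] above [a] on the ball of radius [h (M i j) - a]. The real and
    imaginary parts are the intended [h]. *)
Lemma open_preimage_entry (h : C -> R) (a : R) (i j : 'I_N) :
  (forall z w, `|h z - h w|%:C%C <= `|z - w|) ->
  open [set M : 'M[C : numFieldType]_N | a < h (M i j)].
Proof.
move=> hL; rewrite openE => M /= aM.
have := @coord_continuous C N N i j M.
move/(_ [set z | a < h z]); apply.
apply/nbhs_ballP; exists ((h (M i j) - a)%:C%C); first by rewrite /= ltcR subr_gt0.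
move=> z; rewrite -ball_normE /= => zM.
have := le_lt_trans (hL _ _) zM.
rewrite ltcR => /(le_lt_trans (ler_norm _)).
by rewrite ltrD2l ltrN2.
Qed.

Lemma measurable_entry (h : C -> R) (i j : 'I_N) :
  (forall z w, `|h z - h w|%:C%C <= `|z - w|) ->
  measurable_fun setT (fun V : UN => h (umx V i j)).
Proof.
move=> hL; apply: (measurability _ (RGenOInfty.measurableE R)).
move=> _ [_ [a ->] <-]; rewrite setTI.
apply: sub_sigma_algebra; exists [set M : 'M[C : numFieldType]_N | a < h (M i j)].
  exact: open_preimage_entry.
by apply/seteqP; split=> V /=; rewrite in_itv /= andbT.
Qed.

(** Row [i] has squared norm 1, and one term of that sum cannot exceed the whole. *)
Lemma unitary_entry_le1 (V : unitary_group R N) (i j : 'I_N) : `|umx V i j| <= 1.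
Proof.
have /unitarymxP/matrixP/(_ i i) := umx_unitary V.
rewrite !mxE eqxx mulr1n => Vi.
rewrite -(@ler_pXn2r _ 2)// ?nnegrE// expr1n -Vi (bigD1 j)//= !mxE -normCK lerDl.
by apply: sumr_ge0 => k _; rewrite !mxE mul_conjC_ge0.
Qed.

Lemma cvg_mulmxl_entry (V M : 'M[C : numFieldType]_N) (i j : 'I_N) :
  (V *m X) i j @[X --> M] --> (V *m M) i j.
Proof.
have FM : Filter (nbhs M) by exact: nbhs_filter.
under eq_fun do rewrite mxE.
rewrite mxE; elim: (index_enum _) => [|k r IH].
  rewrite big_nil (_ : (fun X : 'M[C : numFieldType]_N => _) = (fun=> 0)); last first.
    by apply/funext => X; rewrite big_nil.
  exact: cvg_cst.
rewrite big_cons (_ : (fun X : 'M[C : numFieldType]_N => _) = (fun X =>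
  V i k * X k j + \sum_(l <- r) V i l * X l j)); last first.
  by apply/funext => X; rewrite big_cons.
apply: cvgD; last exact: IH.
by apply: cvgMr; exact: coord_continuous.
Qed.

Lemma continuous_mulmxl (V : 'M[C : numFieldType]_N) :
  continuous (fun M : 'M[C : numFieldType]_N => V *m M).
Proof.
move=> M A [Q nQ QA].
(* A neighbourhood of a matrix contains a box of entrywise neighbourhoods [Q]; the finitely many
   entries are treated separately. *)
suff QM : \forall X \near M, forall ij : 'I_N * 'I_N,
    Q ij.1 ij.2 ((V *m X) ij.1 ij.2).
  by apply: filterS QM => X QX; apply: QA => i j; exact: (QX (i, j)).
apply: (@filter_forall _ _ (fun ij => [set X : 'M[C : numFieldType]_N |
  Q ij.1 ij.2 ((V *m X) ij.1 ij.2)]) (nbhs M)) => -[i j] /=.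
by apply: cvg_mulmxl_entry; exact: nQ.
Qed.

Lemma measurable_umul (V : unitary_group R N) :
  measurable_fun setT (umul V : UN -> UN).
Proof.
apply: (@measurability _ _ UN UN setT (umul V) (@unitary_open R N)) => //.
move=> _ [_ [S oS <-] <-]; rewrite setTI; apply: sub_sigma_algebra.
exists (mulmx (umx V) @^-1` S) => //.
have /continuousP cV := @continuous_mulmxl (umx V); exact: cV.
Qed.

End BorelUnitary.

(** * Product sigma-algebra on gate tuples and left invariance of the joint law *)

Section GateTuples.
Context {R : realType} {N D : nat}.
Local Notation C := R[i].
Local Notation UN := (borel_unitary R N).

Definition rectangle (A : 'I_D -> set UN) : set ('I_D -> unitary_group R N) :=
  [set u | forall k, A k (u k)].

Definition rectangles : set (set ('I_D -> unitary_group R N)) :=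
  [set rectangle A | A in [set A | forall k, measurable (A k)]].

Definition gate_tuple := g_sigma_algebraType rectangles.

Definition translate_gate (k : 'I_D) (V : unitary_group R N) (u : gate_tuple)
    : gate_tuple :=
  fun j => if j == k then umul V (u j) else u j.

Lemma setI_closed_rectangles : setI_closed rectangles.
Proof.
move=> _ _ [A mA <-] [B mB <-]; exists (fun k => A k `&` B k).
  by move=> k; exact: measurableI.
by apply/seteqP; split=> [u AB|u [uA uB] k]; split=> //;
  by move=> k; case: (AB k).
Qed.

Lemma measurable_gate (k : 'I_D) :
  measurable_fun setT (fun u : gate_tuple => u k : UN).
Proof.
move=> _ B mB; rewrite setTI; apply: sub_sigma_algebra.
exists (fun j => if j == k then B else setT) => [j|]; first by case: eqP.
apply/seteqP; split=> u /=; first by move/(_ k); rewrite eqxx.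
by move=> uB j; case: eqP => // ->.
Qed.

Lemma measurable_gate_tuple d (T : measurableType d) (f : T -> gate_tuple) :
  (forall k, measurable_fun setT (fun x => f x k : UN)) ->
  measurable_fun setT f.
Proof.
move=> mf; apply: (@measurability _ _ T gate_tuple setT f rectangles) => //.
move=> _ [_ [A mA <-] <-].
rewrite (_ : _ @^-1` _ = \bigcap_k ((fun x => f x k : UN) @^-1` A k)).
  rewrite setTI; apply: fin_bigcap_measurable => //.
  by move=> k _; rewrite -[X in measurable X]setTI; apply: mf.
by apply/seteqP; split=> x /= fx k; [move=> _|]; apply: fx.
Qed.

Lemma measurable_translate_gate (k : 'I_D) (V : unitary_group R N) :
  measurable_fun setT (translate_gate k V).
Proof.
apply: measurable_gate_tuple => j; rewrite /translate_gate.
case: eqP => _; last exact: measurable_gate.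
exact: measurableT_comp (measurable_umul V) (measurable_gate j).
Qed.

Lemma bounded_measurable_gate (k : 'I_D) (i j : 'I_N) :
  bounded_measurable (fun u : gate_tuple => umx (u k) i j).
Proof.
have ReL (z w : C) : `|complex.Re z - complex.Re w|%:C%C <= `|z - w|.
  by rewrite -raddfB; exact: normc_ge_Re.
have ImL (z w : C) : `|complex.Im z - complex.Im w|%:C%C <= `|z - w|.
  (* Up to sign the imaginary part of a number is the real part of its product with ['i]. *)
  rewrite -raddfB /=; have := normc_ge_Re ('i * (z - w)).
  rewrite normrM normCi mul1r; case: (z - w) => a b /=.
  by rewrite mul0r mul1r sub0r normrN.
split.
- exact: measurableT_comp (measurable_entry i j ReL) (measurable_gate k).
- exact: measurableT_comp (measurable_entry i j ImL) (measurable_gate k).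
- exists 1 => u; have V1 := unitary_entry_le1 (u k) i j.
  have := ReL (umx (u k) i j) 0; have := ImL (umx (u k) i j) 0.
  rewrite (_ : complex.Re (0 : C) = 0)// (_ : complex.Im (0 : C) = 0)// !subr0.
  move=> /le_trans/(_ V1) Im1 /le_trans/(_ V1) Re1.
  by rewrite -!lecR.
Qed.

Section Invariance.
Context {d : measure_display} {T : measurableType d}.
Variables (P : probability T R) (U : 'I_D -> {RV P >-> UN}).
Hypothesis haarU : forall k, is_haar (distribution P (U k)).
Hypothesis indepU : mutually_independent U.

Definition joint_gates (x : T) : gate_tuple := fun k => U k x.

Lemma measurable_joint_gates : measurable_fun setT joint_gates.
Proof. by apply: measurable_gate_tuple => k; exact: measurable_funP. Qed.

Lemma joint_gates_rectangle (A : 'I_D -> set UN) :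
  (forall k, measurable (A k)) ->
  P (joint_gates @^-1` rectangle A) = (\prod_k P (U k @^-1` A k))%E.
Proof.
move=> mA; have := indepU [set: 'I_D]%SET mA.
rewrite (eq_bigl xpredT); last by move=> k; rewrite inE.
move=> <-; congr (P _); apply/seteqP; split=> x /= Ax k.
  by move=> _; exact: Ax.
by apply: Ax; rewrite /= inE.
Qed.

(** Both laws are probability measures, so it suffices to compare them on rectangles, a generating
    pi-system. There independence factorizes the measure, and Haar invariance handles the single
    factor [k] that changes. *)
Lemma joint_gates_translate (k : 'I_D) (V : unitary_group R N)
    (A : set gate_tuple) :
  measurable A ->
  P (joint_gates @^-1` A) = P ((translate_gate k V \o joint_gates) @^-1` A).
Proof.
have mJ := measurable_joint_gates.
have mVJ : measurable_fun setT (translate_gate k V \o joint_gates).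
  exact: measurableT_comp (measurable_translate_gate k V) mJ.
pose J : {RV P >-> gate_tuple} :=
  MeasurableFun.Pack (MeasurableFun.Class (isMeasurableFun.Build _ _ _ _ _ mJ)).
pose VJ : {RV P >-> gate_tuple} :=
  MeasurableFun.Pack (MeasurableFun.Class (isMeasurableFun.Build _ _ _ _ _ mVJ)).
pose m1 : {measure set gate_tuple -> \bar R} := distribution P J.
pose m2 : {measure set gate_tuple -> \bar R} := distribution P VJ.
move=> mA; change (m1 A = m2 A).
apply: (@measure_unique _ R gate_tuple rectangles (fun=> setT) erefl
  setI_closed_rectangles _ _ m1 m2) mA => //; last first.
- move=> _; apply: le_lt_trans (ltry 1).
  exact: (probability_le1 (distribution P J) measurableT).
- move=> _ [B mB <-].
  change (P (joint_gates @^-1` rectangle B) =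
    P ((translate_gate k V \o joint_gates) @^-1` rectangle B)).
  (* The preimage of a rectangle under the translation is again a rectangle; only its side [k] is
     replaced. *)
  pose B' (j : 'I_D) : set UN := if j == k then umul V @^-1` B j else B j.
  have mB' j : measurable (B' j).
    rewrite /B'; case: eqP => // _; rewrite -[X in measurable X]setTI.
    exact: measurable_umul.
  have -> : (translate_gate k V \o joint_gates) @^-1` rectangle B =
      joint_gates @^-1` rectangle B'.
    by apply/seteqP; split=> x /= Bx j; have := Bx j; rewrite /B' /translate_gate;
      case: eqP.
  rewrite !joint_gates_rectangle//; apply: eq_bigr => j _.
  rewrite /B'; case: eqP => // _.
  exact/esym/(haarU j V (mB j)).
- by apply/seteqP; split=> // x _; exists 0%N.
- by move=> _; exists (fun=> setT) => //; apply/seteqP; split.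
Qed.

Lemma cexpect_translate (k : 'I_D) (V : unitary_group R N)
    (f : gate_tuple -> C) :
  bounded_measurable f ->
  cexpect P (fun x => f (joint_gates x)) =
  cexpect P (fun x => f (translate_gate k V (joint_gates x))).
Proof.
have mJ := measurable_joint_gates.
have mVJ : measurable_fun setT (translate_gate k V \o joint_gates).
  exact: measurableT_comp (measurable_translate_gate k V) mJ.
have key (g : gate_tuple -> R) : measurable_fun setT g ->
    (exists M : R, forall u, `|g u| <= M) ->
    \int[P]_x g (joint_gates x) =
    \int[P]_x g (translate_gate k V (joint_gates x)).
  move=> mg [M gM]; rewrite /Rintegral; congr fine.
  have ig (h : T -> gate_tuple) : measurable_fun setT h ->
      (\int[P]_x (g (h x))%:E = \int[pushforward P h]_u (g u)%:E)%E.
    move=> mh; rewrite (integral_pushforward mh)//.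
      exact/measurable_EFinP.
    apply: (@bounded_integrable _ _ _ P (g \o h)); first exact: measurableT_comp.
    by exists M => x; exact: gM.
  rewrite (ig _ mJ) (ig _ mVJ); apply: eq_measure_integral => A mA _.
  exact: joint_gates_translate.
move=> [f1 f2 [M Mf]]; congr (_ +i* _)%C.
  by apply: (key (fun u => complex.Re (f u))) => //; exists M => u; case: (Mf u).
by apply: (key (fun u => complex.Im (f u))) => //; exists M => u; case: (Mf u).
Qed.

End Invariance.
End GateTuples.

Arguments gate_tuple : clear implicits.

(** * Trace norm and Hilbert-Schmidt norm *)

Section TraceNorm.
Context {R : realType}.
Local Notation C := R[i].

(** The squared Hilbert-Schmidt norm, kept complex-valued so that it stays within the algebra of
    moments; it is compared through the partial order of [R[i]]. *)
Definition frob2 m n (A : 'M[C]_(m, n)) : C := \sum_i \sum_j A i j * (A i j)^*.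

Lemma frob2E m n (A : 'M[C]_(m, n)) : frob2 A = \tr (A *m A^t*).
Proof.
by apply: eq_bigr => i _; rewrite !mxE; apply: eq_bigr => j _; rewrite !mxE.
Qed.

Lemma frob2_ge0 m n (A : 'M[C]_(m, n)) : 0 <= frob2 A.
Proof.
by apply: sumr_ge0 => i _; apply: sumr_ge0 => j _; exact: mul_conjC_ge0.
Qed.

Lemma frob2_adjoint m n (A : 'M[C]_(m, n)) : frob2 A = \tr (A^t* *m A).
Proof. by rewrite frob2E mxtrace_mulC. Qed.

Lemma adjoint_mul m n p (A : 'M[C]_(m, n)) (B : 'M[C]_(n, p)) :
  (A *m B)^t* = B^t* *m A^t*.
Proof. by rewrite trmx_mul map_mxM. Qed.

Lemma unitary_mulVmx n (U : 'M[C]_n) : U \is unitarymx -> U^t* *m U = 1%:M.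
Proof. by rewrite -trmxC_unitary => /unitarymxP; rewrite trmxCK. Qed.

Lemma frob2_conj n (U X : 'M[C]_n) : U \is unitarymx ->
  frob2 (U *m X *m U^t*) = frob2 X.
Proof.
move=> Uu; rewrite !frob2E !adjoint_mul trmxCK !mulmxA mulmxKtV//.
by rewrite mxtrace_mulC !mulmxA unitary_mulVmx// mul1mx.
Qed.

Lemma mxtrace_conj n (U X : 'M[C]_n) : U \is unitarymx ->
  \tr (U *m X *m U^t*) = \tr X.
Proof. by move=> Uu; rewrite mxtrace_mulC mulmxA unitary_mulVmx// mul1mx. Qed.

Lemma spectral_adjointP n (A : 'M[C]_n) :
  (forall i, 0 <= spectral_diag (A^t* *m A) 0 i) /\
  \sum_i spectral_diag (A^t* *m A) 0 i = frob2 A.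
Proof.
set H := A^t* *m A; set S := spectralmx H; set sp := spectral_diag H.
have Su : S \is unitarymx by exact: spectral_unitarymx.
have : H \is normalmx.
  by apply/normalmxP; rewrite /H adjoint_mul trmxCK.
move/orthomx_spectralP; rewrite -/S -/sp => HE.
(* In the eigenbasis of the Gram matrix the eigenvalues are the squared column norms of [A *m S^t*]:
   this gives positivity, and unitary invariance of the norm gives their sum. *)
have dE : diag_mx sp = (A *m S^t*)^t* *m (A *m S^t*).
  rewrite adjoint_mul trmxCK !mulmxA -(mulmxA S) -/H HE invmx_unitary//.
  by rewrite !mulmxA (unitarymxP Su) mul1mx mulmxtVK.
split.
  move=> i; have : diag_mx sp i i = sp 0 i by rewrite mxE eqxx mulr1n.
  move=> <-; rewrite dE mxE; apply: sumr_ge0 => j _.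
  by rewrite !mxE mulrC mul_conjC_ge0.
rewrite -mxtrace_diag dE -frob2_adjoint !frob2E adjoint_mul trmxCK !mulmxA.
by rewrite -(mulmxA A) unitary_mulVmx// mulmx1.
Qed.

Lemma trace_normE n (A : 'M[C]_n) :
  trace_norm A = complex.Re (\sum_i sqrtC (spectral_diag (A^t* *m A) 0 i)).
Proof.
rewrite /trace_norm /psd_sqrt mxtrace_mulC mulmxA mulmxV ?spectral_unit// mul1mx.
by rewrite mxtrace_diag; congr complex.Re; apply: eq_bigr => i _; rewrite mxE.
Qed.

Lemma Re_ge0 (z : C) : 0 <= z -> 0 <= complex.Re z.
Proof. by case: z => a b; rewrite lecE /= => /andP[]. Qed.

Lemma Re_le (z w : C) : z <= w -> complex.Re z <= complex.Re w.
Proof. by case: z w => a b [c d]; rewrite lecE /= => /andP[]. Qed.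

Lemma trace_norm_ge0 n (A : 'M[C]_n) : 0 <= trace_norm A.
Proof.
rewrite trace_normE; apply/Re_ge0/sumr_ge0 => i _.
by rewrite sqrtC_ge0; exact: (spectral_adjointP A).1.
Qed.

(** Each singular value [s] satisfies [s <= (t + s ^+ 2 / t) / 2]. Optimizing over [t] would give
    the factor [sqrt N]; a free [t] keeps the bound affine in [frob2], so that expectations pass
    through by linearity. *)
Lemma trace_norm_le n (A : 'M[C]_n) (t : R) : 0 < t ->
  trace_norm A <= (n%:R * t + complex.Re (frob2 A) / t) / 2.
Proof.
move=> t0; have [sp0 spS] := spectral_adjointP A.
rewrite trace_normE; set sp := spectral_diag _ in sp0 spS *.
have tC0 : 0 < t%:C%C :> C by rewrite ltcR.
have le1 i : sqrtC (sp 0 i) <= (t%:C%C + sp 0 i / t%:C%C) / 2.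
  (* AM-GM: [(sqrtC x - t) ^+ 2 >= 0]. *)
  have s0 : 0 <= sqrtC (sp 0 i) by rewrite sqrtC_ge0.
  rewrite -[X in _ + X / _](sqrtCK (sp 0 i)).
  set s := sqrtC _ in s0 *.
  rewrite ler_pdivlMr// -(ler_pM2r tC0) mulrDl divfK ?gt_eqF// -subr_ge0.
  have -> : t%:C%C * t%:C%C + s ^+ 2 - s * 2 * t%:C%C = (s - t%:C%C) ^+ 2.
    by ring.
  by rewrite real_exprn_even_ge0// rpredB// ger0_real// ltW.
have -> : (n%:R * t + complex.Re (frob2 A) / t) / 2 =
    complex.Re (\sum_i (t%:C%C + sp 0 i / t%:C%C) / 2).
  rewrite -mulr_suml big_split /= -mulr_suml spS sumr_const card_ord.
  have ReZ (z : C) (a : R) : complex.Re (z / a%:C%C) = complex.Re z / a.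
    by rewrite -fmorphV; case: z => x y; rewrite /= mulr0 subr0.
  have -> : t%:C%C *+ n = (n%:R * t)%:C%C :> C by rewrite mulr_natl rmorphMn.
  have -> : 2 = (2 : R)%:C%C :> C by rewrite rmorph_nat.
  by rewrite ReZ raddfD /= ReZ.
by apply: Re_le; apply: ler_sum => i _; exact: le1.
Qed.

Lemma bounded_measurable_frob2 n d (T : measurableType d) (A : T -> 'M[C]_n) :
  (forall i j, bounded_measurable (fun x => A x i j)) ->
  bounded_measurable (fun x => frob2 (A x)).
Proof.
move=> mA; do 2 (apply: bounded_measurable_sum => ?).
by apply: bounded_measurableM => //; exact: bounded_measurable_conj.
Qed.

End TraceNorm.

(** * Second moments under the Haar measure *)

Section Twirl.
Context {d : measure_display} {T : measurableType d} {R : realType}.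
Variable P : probability T R.
Local Notation C := R[i].

Lemma cexpect_sesquilinear (I : finType) (Z : I -> T -> C) (f g : I -> C) :
  (forall u, bounded_measurable (Z u)) ->
  cexpect P (fun x => (\sum_u f u * Z u x) * (\sum_v g v * Z v x)^*) =
  \sum_u \sum_v f u * (g v)^* * cexpect P (fun x => Z u x * (Z v x)^*).
Proof.
move=> mZ.
have mZZ u v : bounded_measurable (fun x => Z u x * (Z v x)^*).
  by apply: bounded_measurableM => //; exact: bounded_measurable_conj.
have mZc u v : bounded_measurable (fun x => f u * (g v)^* * (Z u x * (Z v x)^*)).
  by apply: bounded_measurableM => //; exact: bounded_measurable_cst.
transitivity (cexpect P (fun x =>
    \sum_u \sum_v f u * (g v)^* * (Z u x * (Z v x)^*))).
  congr cexpect; apply/funext => x; rewrite rmorph_sum /= mulr_suml.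
  apply: eq_bigr => u _; rewrite mulr_sumr; apply: eq_bigr => v _.
  by rewrite rmorphM /=; ring.
rewrite cexpect_sum => [|u]; last exact: bounded_measurable_sum.
apply: eq_bigr => u _; rewrite cexpect_sum //; apply: eq_bigr => v _.
by rewrite cexpectZ.
Qed.

Variables (N : nat) (Y : T -> 'M[C]_N).
Hypothesis mY : forall i j, bounded_measurable (fun x => Y x i j).

Definition moment (i j k l : 'I_N) : C :=
  cexpect P (fun x => Y x i j * (Y x k l)^*).

Hypothesis invY : forall V : 'M[C]_N, V \is unitarymx -> forall i j k l,
  moment i j k l = cexpect P (fun x =>
    (V *m Y x *m V^t*) i j * ((V *m Y x *m V^t*) k l)^*).

(** Conjugation by the diagonal unitary with entry ['i] at [p] and 1 elsewhere multiplies each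
    matrix entry by a phase. *)
Lemma moment_phase (p i j k l : 'I_N) :
  moment i j k l =
  'i ^+ (i == p) * ('i ^+ (j == p))^* * ('i ^+ (k == p))^* * 'i ^+ (l == p)
  * moment i j k l.
Proof.
pose v : 'rV[C]_N := \row_a 'i ^+ (a == p).
have VE a b (M : 'M[C]_N) : (diag_mx v *m M *m (diag_mx v)^t*) a b =
    'i ^+ (a == p) * M a b * ('i ^+ (b == p))^*.
  by rewrite tr_diag_mx map_diag_mx mul_mx_diag mul_diag_mx !mxE.
have Vu : diag_mx v \is unitarymx.
  apply/unitarymxP/matrixP => a b; have := VE a b 1%:M.
  rewrite mulmx1 => ->; rewrite !mxE.
  case: (a =P b) => [<-|_]; last by rewrite mulr0 mul0r.
  by rewrite mulr1 -normCK normrX normCi !expr1n.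
rewrite [LHS](invY Vu) /moment -cexpectZ; last first.
  by apply: bounded_measurableM => //; exact: bounded_measurable_conj.
congr cexpect; apply/funext => x; rewrite !VE !rmorphM /= conjCK; ring.
Qed.

Lemma eq0_of_scale (c m : C) : c != 1 -> m = c * m -> m = 0.
Proof.
move=> c1 /eqP; rewrite -[X in X == _]mul1r -subr_eq0 -mulrBl mulf_eq0 subr_eq0.
by rewrite eq_sym (negPf c1) => /eqP.
Qed.

(** For any other index pattern some choice of [p] gives a phase factor different from 1. The phase
    ['i] is used because the pattern [i = l], [j = k] with [i != j] then gets the factor -1; a sign
    flip would not detect it. *)
Lemma moment_eq0 (i j k l : 'I_N) :
  ~~ ((i == j) && (k == l) || (i == k) && (j == l)) -> moment i j k l = 0.
Proof.
have iN1 : 'i != 1 :> C.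
  by rewrite eq_complex /= (eq_sym 0) oner_eq0.
have iJ : ('i)^* != 1 :> C.
  by rewrite conjCi eq_complex /= oppr0 (eq_sym 0) oner_eq0.
have ii : 'i * 'i != 1 :> C.
  rewrite -expr2 sqrCi -subr_eq0 -opprD oppr_eq0.
  by rewrite (_ : 1 + 1 = 2%:R)// pnatr_eq0.
case: (i =P j) => [<-|/eqP ij]; case: (i =P k) => [<-|/eqP ik] /=.
- move=> il; apply: (eq0_of_scale _ (moment_phase l i i i l)).
  rewrite orbb in il.
  by rewrite (negPf il) eqxx /= expr0 expr1 rmorph1 !mul1r.
- rewrite orbF => kl; apply: (eq0_of_scale _ (moment_phase l i i k l)).
  rewrite (negPf kl) eqxx /= expr0 expr1 rmorph1 mulr1.
  case: (i == l); rewrite /= ?expr0 ?expr1 ?rmorph1 ?mul1r //.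
  by rewrite -normCK normCi expr1n mul1r.
- move=> jl; apply: (eq0_of_scale _ (moment_phase j i j i l)).
  rewrite (negPf ij) eqxx [l == j]eq_sym (negPf jl) /= expr0 expr1.
  by rewrite rmorph1 mul1r !mulr1.
- move=> _; apply: (eq0_of_scale _ (moment_phase i i j k l)).
  rewrite eqxx [j == i]eq_sym (negPf ij) [k == i]eq_sym (negPf ik) /=.
  rewrite expr0 rmorph1 expr1 !mulr1.
  by case: (l == i); rewrite /= ?expr0 ?expr1 ?mulr1; [exact: ii | exact: iN1].
Qed.

Lemma moment_perm (s : {perm 'I_N}) (i j k l : 'I_N) :
  moment i j k l = moment (s i) (s j) (s k) (s l).
Proof.
have VE a b (M : 'M[C]_N) : (perm_mx s *m M *m (perm_mx s)^t*) a b = M (s a) (s b).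
  by rewrite tr_perm_mx map_perm_mx -row_permE -col_permE !mxE.
have Vu : (perm_mx s : 'M[C]_N) \is unitarymx.
  apply/unitarymxP; rewrite tr_perm_mx map_perm_mx -perm_mxM.
  by rewrite mulgV perm_mx1.
rewrite (invY Vu) /moment; congr cexpect; apply/funext => x.
by rewrite !VE.
Qed.

Lemma exists_perm2 (i j i' j' : 'I_N) : i != j -> i' != j' ->
  exists s : {perm 'I_N}, s i = i' /\ s j = j'.
Proof.
(* The first transposition places [i]; the second corrects the image of [j] and fixes [i']. *)
move=> ij ij'; exists (tperm i i' * tperm (tperm i i' j) j')%g.
rewrite !permM (tpermL (tperm i i' j)) (tpermL i i'); split=> //.
rewrite (@tpermD _ (tperm i i' j) j') // 1?eq_sym //.
by rewrite -[X in X != _](tpermL i i') (inj_eq perm_inj).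
Qed.

Variables (p q : 'I_N).
Hypothesis pq : p != q.

(** Permutation invariance leaves three values: [beta] for the pairing of the two entries, [delta]
    for the pairing within each entry, and the excess [eps] where both pairings coincide. The
    reflection below eliminates [eps]. *)
Let beta := moment p q p q.
Let delta := moment p p q q.
Let eps := moment p p p p - beta - delta.

Let momentE_eps (a b c e : 'I_N) : moment a b c e =
  beta * ((a == c) && (b == e))%:R + delta * ((a == b) && (c == e))%:R
  + eps * [&& a == b, c == e & a == c]%:R.
Proof.
case: (a =P b) => [<-|/eqP ab].
  case: (c =P e) => [<-|/eqP ce].
    case: (a =P c) => [<-|/eqP ac] /=.
      by rewrite (moment_perm (tperm a p)) !tpermL !mulr1 /eps; ring.
    have [s [sa sc]] := exists_perm2 ac pq.
    by rewrite (moment_perm s) sa sc !mulr0 mulr1 addr0 add0r.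
  have ae : (a == c) && (a == e) = false.
    by apply: contra_neqF ce => /andP[/eqP <- /eqP <-].
  by rewrite moment_eq0 ?ae ?orbF ?(negPf ce) ?andbF //= !mulr0 !addr0.
have [/andP[/eqP <- /eqP <-] | ne] := boolP ((a == c) && (b == e)).
  have [s [sa sb]] := exists_perm2 ab pq.
  by rewrite (moment_perm s) sa sb /= !mulr0 mulr1 !addr0.
by rewrite moment_eq0 ?(negPf ab) ?(negPf ne) //= !mulr0 !addr0.
Qed.

Definition form (h : 'I_N -> 'I_N -> C) (x : T) : C :=
  \sum_i \sum_j h i j * Y x i j.

Let cexpect_form_eps (h : 'I_N -> 'I_N -> C) :
  cexpect P (fun x => form h x * (form h x)^*) =
  beta * (\sum_i \sum_j h i j * (h i j)^*)
  + delta * ((\sum_i h i i) * (\sum_i h i i)^*)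
  + eps * \sum_i h i i * (h i i)^*.
Proof.
pose h' (u : 'I_N * 'I_N) := h u.1 u.2.
(* [hd] is the diagonal part of the coefficients, so that all three terms become sums over pairs of
   indices. *)
pose hd (u : 'I_N * 'I_N) := h' u * (u.1 == u.2)%:R.
transitivity (cexpect P (fun x => (\sum_u h' u * Y x u.1 u.2) *
    (\sum_v h' v * Y x v.1 v.2)^*)).
  by congr cexpect; apply/funext => x; rewrite /form !pair_bigA.
rewrite (cexpect_sesquilinear (Z := fun u x => Y x u.1 u.2)) //.
transitivity (\sum_u \sum_v (beta * (h' u * (h' v)^* * (u == v)%:R)
    + delta * (hd u * (hd v)^*) + eps * (hd u * (hd v)^* * (u == v)%:R))).
  apply: eq_bigr => -[a b] _; apply: eq_bigr => -[c e] _.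
  rewrite -/(moment a b c e) momentE_eps /hd rmorphM /= rmorph_nat xpair_eqE.
  case: (a =P b) => [<-|_]; case: (c =P e) => [<-|_] /=;
    case: (a == c) => /=; try (case: (_ == _) => /=); ring.
have sum_eq (F : 'I_N * 'I_N -> 'I_N * 'I_N -> C) u :
    \sum_v F u v * (u == v)%:R = F u u.
  rewrite (bigD1 u)//= eqxx mulr1 big1 ?addr0// => v /negPf.
  by rewrite eq_sym => ->; rewrite mulr0.
have sum_diag (F : 'I_N -> 'I_N -> C) :
    \sum_u F u.1 u.2 * (u.1 == u.2)%:R = \sum_i F i i.
  rewrite -(pair_bigA _ (fun i j => F i j * (i == j)%:R)) /=.
  apply: eq_bigr => i _; rewrite (bigD1 i)//= eqxx mulr1 big1 ?addr0// => j.
  by rewrite eq_sym => /negPf ->; rewrite mulr0.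
under eq_bigr do rewrite !big_split /= -!mulr_sumr.
rewrite !big_split /= -!mulr_sumr; congr (_ * _ + _ * _ + _ * _).
- rewrite [RHS]pair_bigA /=; apply: eq_bigr => u _.
  exact: (sum_eq (fun u v => h' u * (h' v)^*)).
- rewrite -mulr_suml -rmorph_sum /=; congr (_ * _^*); exact: sum_diag.
- rewrite -(sum_diag (fun i j => h i j * (h i j)^*)); apply: eq_bigr => u _.
  rewrite (sum_eq (fun u v => hd u * (hd v)^*)) /hd rmorphM /= rmorph_nat.
  by case: (_ == _); rewrite ?mulr1 ?mulr0 ?mul0r.
Qed.

(* The entries [3/5], [-4/5] of column [p] make the fourth moment of the
   amplitudes differ from 1, which forces [eps = 0]. *)
Let z : 'cV[C]_N := delta_mx p 0 + 2 *: delta_mx q 0.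
Let reflection : 'M[C]_N := 1%:M - (2 / 5) *: (z *m z^T).

Let reflection_sym : reflection^t* = reflection.
Proof.
have zJ : map_mx Num.conj z = z.
  apply/matrixP => i j; rewrite !mxE rmorphD rmorphM /= !rmorph_nat.
  by [].
rewrite /reflection raddfB /= trmx1 map_mxB map_mx1 linearZ /= map_mxZ.
rewrite trmx_mul trmxK map_mxM -map_trmx zJ.
by rewrite rmorphM /= fmorphV !rmorph_nat.
Qed.

Let reflection_unitary : reflection \is unitarymx.
Proof.
(* Since [z] has squared length 5, the coefficient [2 / 5] makes this a Householder reflection, a
   self-adjoint involution. *)
have zz : z^T *m z = (5 : C)%:M.
  have qp : q != p by rewrite eq_sym.
  rewrite [LHS]mx11_scalar; congr _%:M; rewrite mxE (bigD1 p)//= (bigD1 q)//=.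
  rewrite !mxE !eqxx (negPf pq) (negPf qp) /= big1 ?addr0; first by ring.
  by move=> i /andP[/negPf ip /negPf iq]; rewrite !mxE ip iq !mulr0 addr0 mul0r.
apply/unitarymxP; rewrite reflection_sym /reflection.
rewrite mulmxBl mul1mx mulmxBr mulmx1 -scalemxAl -scalemxAr mulmxA -(mulmxA z) zz.
rewrite mul_mx_scalar -scalemxAl !scalerA.
have -> : 2 / 5 * (2 / 5 * 5) = 2 / 5 + 2 / 5 :> C by field.
by rewrite scalerDl opprB addrK subrK.
Qed.

Let reflection_row (a : 'I_N) :
  reflection p a = 3 / 5 * (a == p)%:R - 4 / 5 * (a == q)%:R.
Proof.
rewrite !mxE big_ord1 !mxE !eqxx !andbT (negPf pq) (eq_sym p a).
by case: (a == p); case: (a == q) => /=; field.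
Qed.

Let reflection_row_sum (n : nat) :
  \sum_a reflection p a ^+ n.+1 = (3 / 5) ^+ n.+1 + (- (4 / 5)) ^+ n.+1.
Proof.
have qp : q != p by rewrite eq_sym.
rewrite (bigD1 p)//= (bigD1 q)//= !reflection_row !eqxx (negPf pq) (negPf qp).
rewrite !mulr0 !mulr1 subr0 sub0r big1 ?addr0// => i /andP[/negPf ip /negPf iq].
by rewrite reflection_row ip iq !mulr0 subr0 expr0n.
Qed.

Let eps0 : eps = 0.
Proof.
have rJ a : (reflection p a)^* = reflection p a.
  by rewrite reflection_row rmorphB !rmorphM /= !fmorphV !rmorph_nat.
pose h a b := reflection p a * reflection p b.
have hJ a b : (h a b)^* = h a b by rewrite rmorphM /= !rJ.
have := cexpect_form_eps h.
(* Invariance under the reflection turns the entry [(p, p)] into the form with coefficients [h], so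
   the same moment is evaluated in two ways. *)
have -> : cexpect P (fun x => form h x * (form h x)^*) = moment p p p p.
  rewrite (invY reflection_unitary); congr cexpect; apply/funext => x.
  have -> // : (reflection *m Y x *m reflection^t*) p p = form h x.
  rewrite mxE /form [RHS]exchange_big /=; apply: eq_bigr => b _.
  have -> : reflection^t* b p = reflection p b by rewrite 2!mxE rJ.
  by rewrite mxE mulr_suml; apply: eq_bigr => a _; rewrite /h; ring.
have sumh2 : \sum_i \sum_j h i j * (h i j)^* = 1.
  transitivity ((\sum_i reflection p i ^+ 2) * (\sum_j reflection p j ^+ 2)).
    rewrite mulr_suml; apply: eq_bigr => i _; rewrite mulr_sumr.
    by apply: eq_bigr => j _; rewrite hJ /h; ring.
  by rewrite reflection_row_sum; field.
have sumh1 : \sum_i h i i = 1.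
  transitivity (\sum_i reflection p i ^+ 2); first exact: eq_bigr.
  by rewrite reflection_row_sum; field.
have sumh4 : \sum_i h i i * (h i i)^* = 337 / 625.
  transitivity (\sum_i reflection p i ^+ 4).
    by apply: eq_bigr => i _; rewrite hJ /h; ring.
  by rewrite reflection_row_sum; field.
rewrite sumh2 sumh1 sumh4 rmorph1 => H.
have E : moment p p p p = beta + delta + eps by rewrite /eps; ring.
(* Here [288 / 625 = 1 - 337 / 625], where [337 = 3 ^ 4 + 4 ^ 4]; the [beta] and [delta] terms
   cancel. *)
have : 288 / 625 * eps = 0.
  have -> : 288 / 625 * eps = (beta + delta + eps) -
    (beta * 1 + delta * (1 * 1) + eps * (337 / 625)) by field.
  by rewrite -H E subrr.
by move/eqP; rewrite mulf_eq0 mulf_eq0 invr_eq0 !pnatr_eq0 /= => /eqP.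
Qed.

(** Two linear relations determine the remaining unknowns: the vanishing trace expresses [delta]
    through [beta], and the expected squared norm fixes [beta]. *)
Lemma cexpect_form (h : 'I_N -> 'I_N -> C) :
  (forall x, \tr (Y x) = 0) ->
  cexpect P (fun x => form h x * (form h x)^*) =
  cexpect P (fun x => frob2 (Y x)) / (N%:R ^+ 2 - 1) *
  (\sum_i \sum_j h i j * (h i j)^*
   - (\sum_i h i i) * (\sum_i h i i)^* / N%:R).
Proof.
move=> trY.
have N1 : (1 < N)%N.
  case: N p q pq => [[]//|[|//]] a b; by rewrite !ord1 eqxx.
have N0 : N%:R != 0 :> C by rewrite pnatr_eq0 -lt0n ltnW.
have N2 : N%:R ^+ 2 - 1 != 0 :> C.
  by rewrite subr_eq0 -natrX (eqr_nat _ _ 1) -(exp1n 2) eqn_exp2r// gtn_eqF.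
have sumN : \sum_(i < N) (1 : C) = N%:R by rewrite sumr_const card_ord.
(* With identity coefficients the form is the trace, whence [0 = beta * N + delta * N ^ 2]. *)
have deltaE : delta = - beta / N%:R.
  have := cexpect_form_eps (fun i j => (i == j)%:R).
  have -> : cexpect P (fun x => form (fun i j => (i == j)%:R) x *
      (form (fun i j => (i == j)%:R) x)^*) = 0.
    rewrite -[RHS](cexpect_cst P 0); congr cexpect; apply/funext => x.
    suff -> : form (fun i j => (i == j)%:R) x = \tr (Y x) by rewrite trY mul0r.
    apply: eq_bigr => i _; rewrite (bigD1 i)//= eqxx mul1r big1 ?addr0// => j.
    by rewrite eq_sym => /negPf ->; rewrite mul0r.
  have rowE i : \sum_(j < N) (i == j)%:R * ((i == j)%:R)^* = 1 :> C.
    rewrite (bigD1 i)//= eqxx rmorph_nat mulr1 big1 ?addr0// => j.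
    by rewrite eq_sym => /negPf ->; rewrite mul0r.
  have diagE : \sum_(i < N) (i == i)%:R = N%:R :> C.
    by under eq_bigr do rewrite eqxx.
  rewrite (eq_bigr _ (fun i _ => rowE i)) diagE.
  rewrite sumN rmorph_nat eps0 mul0r addr0 => H.
  have -> : delta = (beta * N%:R + delta * (N%:R * N%:R) - beta * N%:R)
    / (N%:R * N%:R) by field.
  by rewrite -H; field.
have frobE : cexpect P (fun x => frob2 (Y x)) = beta * (N%:R ^+ 2 - 1).
  have mYY i j : bounded_measurable (fun x => Y x i j * (Y x i j)^*).
    by apply: bounded_measurableM => //; exact: bounded_measurable_conj.
  transitivity (\sum_i \sum_j moment i j i j).
    rewrite /frob2 cexpect_sum => [|i]; last exact: bounded_measurable_sum.
    by apply: eq_bigr => i _; rewrite cexpect_sum.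
  transitivity (\sum_(i < N) (beta * N%:R + delta)).
    apply: eq_bigr => i _.
    under eq_bigr do rewrite momentE_eps eps0 mul0r addr0 !eqxx mulr1 andbb.
    rewrite big_split /= sumr_const card_ord mulr_natr; congr (_ + _).
    rewrite (bigD1 i)//= eqxx mulr1 big1 ?addr0// => j.
    by rewrite eq_sym => /negPf ->; rewrite mulr0.
  by rewrite sumr_const card_ord -mulr_natr deltaE; field.
rewrite cexpect_form_eps eps0 mul0r addr0 deltaE frobE.
by field; rewrite N0 N2.
Qed.

End Twirl.

(** * The noise channel *)

Section TensorChannel.
Context {R : realType}.
Local Notation C := R[i].

Lemma mxtrace_delta_mx n (i j : 'I_n) : \tr (delta_mx i j : 'M[C]_n) = (i == j)%:R.
Proof.
rewrite /mxtrace (bigD1 i)//= mxE eqxx /= big1 ?addr0// => k /negPf ki.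
by rewrite mxE ki.
Qed.

Lemma sum_bits_prod n (F : 'I_n -> 'I_2 -> C) :
  \sum_(i < qdim n) \prod_q F q (bits i q) = \prod_q \sum_u F q u.
Proof.
rewrite bigA_distr_bigA /=.
rewrite (reindex (@bits n)) //=.
exact: onW_bij (enum_val_bij _).
Qed.

Lemma bits_inj n : injective (@bits n).
Proof. exact: enum_val_inj. Qed.

Lemma prod_bits_eq n (i j : 'I_(qdim n)) :
  \prod_q (bits i q == bits j q)%:R = (i == j)%:R :> C.
Proof.
case: eqP => [<-|ij]; first by rewrite big1 // => q _; rewrite eqxx.
have [q ijq] : exists q, bits i q != bits j q.
  apply/existsP; rewrite -negb_forall; apply/negP => /forallP ij'.
  by apply/ij/bits_inj/ffunP => q; apply/eqP.
by rewrite (bigD1 q)//= (negPf ijq) mul0r.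
Qed.

(** The matrix of the tensor channel in the basis of matrix units: the weight of input entry
    [(i, j)] in output entry [(a, b)]. *)
Definition channel_entry n (Phi : 'M[C]_2 -> 'M[C]_2) (a b i j : 'I_(qdim n)) : C :=
  \prod_q Phi (delta_mx (bits i q) (bits j q)) (bits a q) (bits b q).

Lemma tensor_channelE n Phi (X : 'M[C]_(qdim n)) a b :
  tensor_channel Phi X a b = \sum_i \sum_j channel_entry Phi a b i j * X i j.
Proof.
rewrite /tensor_channel summxE; apply: eq_bigr => i _.
by rewrite summxE; apply: eq_bigr => j _; rewrite !mxE mulrC.
Qed.

Lemma sum_channel_entry_diag n Phi a b :
  \sum_i channel_entry Phi a b i i = tensor_channel Phi (1%:M : 'M[C]_(qdim n)) a b.
Proof.
rewrite tensor_channelE; apply: eq_bigr => i _.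
rewrite (bigD1 i)//= mxE eqxx mulr1 big1 ?addr0// => j.
by rewrite mxE eq_sym => /negPf ->; rewrite mulr0.
Qed.

Lemma mxtrace_tensor_channel n Phi (X : 'M[C]_(qdim n)) :
  (forall A, \tr (Phi A) = \tr A) -> \tr (tensor_channel Phi X) = \tr X.
Proof.
move=> trPhi; rewrite /mxtrace.
under eq_bigr do rewrite tensor_channelE.
rewrite exchange_big; apply: eq_bigr => i _ /=.
rewrite exchange_big (bigD1 i)//= [X in _ + X]big1 ?addr0 => [|j /negPf ji];
  rewrite -mulr_suml (sum_bits_prod (fun q u => Phi _ u u)).
- rewrite big1 ?mul1r// => q _; have := trPhi (delta_mx (bits i q) (bits i q)).
  by rewrite /mxtrace => ->; rewrite -/(mxtrace _) mxtrace_delta_mx eqxx.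
- have -> : \prod_q \sum_u Phi (delta_mx (bits i q) (bits j q)) u u =
      (i == j)%:R :> C.
    rewrite -prod_bits_eq; apply: eq_bigr => q _.
    by rewrite -/(mxtrace _) trPhi mxtrace_delta_mx.
  by rewrite eq_sym ji mul0r.
Qed.

(** The squared Hilbert-Schmidt norm of a linear map on matrices is multiplicative under tensor
    powers: each of the four sums over bit strings distributes over the qubits. *)
Lemma sum_channel_entry_sqr n Phi :
  \sum_a \sum_b \sum_i \sum_j channel_entry (n := n) Phi a b i j *
    (channel_entry Phi a b i j)^* =
  (\sum_x \sum_y frob2 (Phi (delta_mx x y))) ^+ n.
Proof.
pose F u v x y : C := Phi (delta_mx x y) u v * (Phi (delta_mx x y) u v)^*.
transitivity (\sum_(a < qdim n) \sum_(b < qdim n) \sum_(i < qdim n)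
    \sum_(j < qdim n) \prod_q F (bits a q) (bits b q) (bits i q) (bits j q)).
  do 4 (apply: eq_bigr => ? _).
  by rewrite /channel_entry rmorph_prod -big_split.
under eq_bigr => a _ do under eq_bigr => b _ do under eq_bigr => i _ do
  rewrite (sum_bits_prod (fun q y => F (bits a q) (bits b q) (bits i q) y)).
under eq_bigr => a _ do under eq_bigr => b _ do
  rewrite (sum_bits_prod (fun q x => \sum_y F (bits a q) (bits b q) x y)).
under eq_bigr => a _ do
  rewrite (sum_bits_prod (fun q v => \sum_x \sum_y F (bits a q) v x y)).
rewrite (sum_bits_prod (fun q u => \sum_v \sum_x \sum_y F u v x y)).
rewrite prodr_const card_ord; congr (_ ^+ _).
under eq_bigr => u _ do rewrite exchange_big.
rewrite exchange_big; apply: eq_bigr => x _.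
under eq_bigr => u _ do rewrite exchange_big.
by rewrite exchange_big.
Qed.

(** Expand the nonnegative sum of [|A i i - 1| ^ 2] and discard the off-diagonal entries. *)
Lemma frob2_ge_trace n (A : 'M[C]_n) : \tr A = n%:R -> n%:R <= frob2 A.
Proof.
move=> trA; have dJ : (\sum_i A i i)^* = n%:R by rewrite -/(mxtrace A) trA rmorph_nat.
have : 0 <= \sum_i (A i i - 1) * (A i i - 1)^*.
  by apply: sumr_ge0 => i _; exact: mul_conjC_ge0.
have -> : \sum_i (A i i - 1) * (A i i - 1)^* = \sum_i A i i * (A i i)^* - n%:R.
  transitivity (\sum_i (A i i * (A i i)^* - A i i - (A i i)^* + 1)).
    by apply: eq_bigr => i _; rewrite rmorphB rmorph1; ring.
  have dJ' : \sum_i (A i i)^* = n%:R by rewrite -dJ rmorph_sum.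
  rewrite !big_split /= !sumrN dJ' -/(mxtrace A) trA sumr_const card_ord.
  by rewrite addrNK.
rewrite subr_ge0 => /le_trans; apply; apply: ler_sum => i _.
rewrite (bigD1 i)//= lerDl; apply: sumr_ge0 => j _; exact: mul_conjC_ge0.
Qed.

End TensorChannel.

(** * The single-qubit replacement channel *)

Section Replacement.
Context {R : realType}.
Local Notation C := R[i].
Variables (gamma : R) (sigma : 'M[C]_2).
Hypothesis gamma01 : 0 < gamma <= 1.
Hypothesis dsigma : is_density sigma.

Local Notation Phi := (replacement_channel gamma sigma).

Lemma mxtrace_replacement A : \tr (Phi A) = \tr A.
Proof.
have [_ _ tr1] := dsigma.
rewrite /replacement_channel mxtraceD !mxtraceZ tr1 mulr1 -mulrDl.
by rewrite -rmorphD /= subrK mul1r.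
Qed.

(** For a 2 by 2 matrix of trace 1 the deficit [1 - frob2 sigma] is twice the determinant, so
    positivity of the determinant suffices. *)
Lemma density_frob2_le1 : frob2 sigma <= 1.
Proof.
have [/is_hermitianmxP herm psd tr1] := dsigma.
have sJ i j : (sigma i j)^* = sigma j i.
  by move/matrixP/(_ j i) : herm; rewrite expr0 scale1r !mxE.
have tr2 : sigma 0 0 + sigma 1 1 = 1.
  rewrite -tr1 /mxtrace !big_ord_recl big_ord0 addr0.
  by congr (_ + sigma _ _); apply/val_inj.
(* [v0] and [v1] are the columns of the adjugate; their quadratic forms are the determinant times
   [sigma 0 0] and [sigma 1 1], which add up to the determinant. *)
pose v0 : 'cV[C]_2 := \col_i (if i == 0 then - sigma 0 1 else sigma 0 0).
pose v1 : 'cV[C]_2 := \col_i (if i == 0 then sigma 1 1 else - sigma 1 0).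
have l1 : lift 0 0 = 1 :> 'I_2 by apply/val_inj.
have det_ge0 : sigma 0 1 * sigma 1 0 <= sigma 0 0 * sigma 1 1.
  have := addr_ge0 (psd v0) (psd v1).
  rewrite !mxE !big_ord_recl !big_ord0 !mxE !big_ord_recl !big_ord0 !mxE /= !l1.
  rewrite !rmorphN /= !sJ => H; rewrite -subr_ge0.
  rewrite -[_ - _]mul1r -tr2; apply: le_trans H _; rewrite le_eqVlt; apply/orP; left.
  by apply/eqP; ring.
have -> : 1 = (sigma 0 0 + sigma 1 1) ^+ 2 by rewrite tr2 expr1n.
rewrite /frob2 !big_ord_recl !big_ord0 !l1 !sJ -subr_ge0.
have -> : (sigma 0 0 + sigma 1 1) ^+ 2 -
  (sigma 0 0 * sigma 0 0 + (sigma 0 1 * sigma 1 0 + 0) +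
   (sigma 1 0 * sigma 0 1 + (sigma 1 1 * sigma 1 1 + 0) + 0)) =
  2 * (sigma 0 0 * sigma 1 1 - sigma 0 1 * sigma 1 0) by ring.
by rewrite mulr_ge0// subr_ge0.
Qed.

Lemma replacement_frob2_le :
  \sum_x \sum_y frob2 (Phi (delta_mx x y)) <= 4 * (1 - gamma / 2)%:C%C.
Proof.
have [/is_hermitianmxP herm _ tr1] := dsigma.
have sJ i j : (sigma i j)^* = sigma j i.
  by move/matrixP/(_ j i) : herm; rewrite expr0 scale1r !mxE.
have l1 : lift 0 0 = 1 :> 'I_2 by apply/val_inj.
have tr2 : sigma 0 0 = 1 - sigma 1 1.
  by rewrite -tr1 /mxtrace !big_ord_recl big_ord0 addr0 l1 addrK.
pose g := gamma%:C%C : C.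
have gJ : g^* = g by apply/eqP; rewrite eq_complex /= oppr0 !eqxx.
have rE : (1 - gamma / 2)%:C%C = 1 - g / 2 :> C.
  by rewrite rmorphB rmorph1 rmorphM /= fmorphV rmorph_nat.
have -> : \sum_x \sum_y frob2 (Phi (delta_mx x y)) =
    4 * (1 - g) ^+ 2 + 2 * g * (1 - g) + 2 * g ^+ 2 * frob2 sigma.
  rewrite /frob2 !big_ord_recl !big_ord0 !l1 !mxE /=.
  rewrite !mxtrace_delta_mx /=.
  rewrite (_ : (1 - gamma)%:C%C = 1 - g); last by rewrite rmorphB rmorph1.
  rewrite -/g !(rmorphD, rmorphN, rmorphM, rmorph1, rmorph0) /= !sJ !gJ.
  by rewrite (_ : ord0 = 0) ?tr2; [ring | apply/val_inj].
apply: (@le_trans _ _ (4 * (1 - g) ^+ 2 + 2 * g * (1 - g) + 2 * g ^+ 2 * 1)).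
  rewrite lerD2l ler_wpM2l// ?density_frob2_le1//.
  by rewrite mulr_ge0// exprn_ge0// /g lecR; case/andP: gamma01 => /ltW.
rewrite rE -subr_ge0.
(* After bounding the purity by 1, the slack in the estimate is exactly [4 * g * (1 - g)]. *)
have -> : 4 * (1 - g / 2) - (4 * (1 - g) ^+ 2 + 2 * g * (1 - g) + 2 * g ^+ 2 * 1) =
  4 * (g * (1 - g)) by field.
case/andP: gamma01 => g0 g1.
have gC0 : 0 <= g by rewrite ler0c ltW.
have gC1 : g <= 1 by rewrite -(rmorph1 (real_complex R)) lecR.
by rewrite mulr_ge0// mulr_ge0// subr_ge0.
Qed.

End Replacement.

(** * Contraction along the circuit *)

Section Circuit.
Context {R : realType} {n D : nat}.
Local Notation C := R[i].
Local Notation N := (qdim n).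
Variables (gamma : R) (sigma : 'M[C]_2).
Hypothesis n_gt0 : (0 < n)%N.
Hypothesis gamma01 : 0 < gamma <= 1.
Hypothesis dsigma : is_density sigma.
Variable X0 : 'M[C]_N.
Hypothesis trX0 : \tr X0 = 0.

Local Notation Phi := (replacement_channel gamma sigma).

Definition state_after (m : nat) (u : gate_tuple R N D) : 'M[C]_N :=
  noisy_circuit Phi (take m [seq umx (u k) | k <- enum 'I_D]) X0.

(** The state between gate [k] and the noise that follows it; the twirl formula is applied to this
    matrix. *)
Definition rotated_state (k : 'I_D) (u : gate_tuple R N D) : 'M[C]_N :=
  umx (u k) *m state_after k u *m (umx (u k))^t*.

Lemma state_after0 u : state_after 0 u = X0.
Proof. by rewrite /state_after take0. Qed.

Lemma state_afterS (k : 'I_D) u :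
  state_after k.+1 u = tensor_channel Phi (rotated_state k u).
Proof.
rewrite /state_after (take_nth 0); last by rewrite size_map size_enum_ord.
rewrite /noisy_circuit foldl_rcons (nth_map k); last by rewrite size_enum_ord.
by rewrite nth_ord_enum.
Qed.

Lemma state_after_ind (Q : nat -> Prop) : Q 0%N ->
  (forall k : 'I_D, Q k -> Q k.+1) -> forall m, (m <= D)%N -> Q m.
Proof.
move=> Q0 QS; elim=> [//|m IH] mD.
exact: (QS (Ordinal mD) (IH (ltnW mD))).
Qed.

(** The first [m] layers involve only gates of index below [m <= k], which the translation leaves
    alone. *)
Lemma state_after_translate (k : 'I_D) V u m : (m <= k)%N ->
  state_after m (translate_gate k V u) = state_after m u.
Proof.
move=> mk; have mD : (m <= D)%N by rewrite (leq_trans mk)// ltnW.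
move: m mD mk.
apply: (@state_after_ind (fun m => (m <= k)%N -> _)) => [|j IH jk].
  by rewrite !state_after0.
rewrite !state_afterS /rotated_state (IH (ltnW jk)) /translate_gate.
by rewrite (_ : j == k = false) //; apply/negbTE; rewrite neq_ltn jk.
Qed.

Lemma rotated_state_translate (k : 'I_D) V u :
  rotated_state k (translate_gate k V u) =
  umx V *m rotated_state k u *m (umx V)^t*.
Proof.
rewrite /rotated_state state_after_translate// /translate_gate eqxx /=.
by rewrite adjoint_mul !mulmxA.
Qed.

Lemma mxtrace_rotated_state (k : 'I_D) u :
  \tr (rotated_state k u) = \tr (state_after k u).
Proof. by rewrite mxtrace_conj//; exact: umx_unitary. Qed.

Lemma mxtrace_state_after m u : (m <= D)%N -> \tr (state_after m u) = 0.
Proof.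
move: m; apply: state_after_ind => [|k IH]; first by rewrite state_after0.
by rewrite state_afterS mxtrace_tensor_channel ?mxtrace_rotated_state// => A;
  exact: mxtrace_replacement.
Qed.

Lemma bounded_measurable_rotated_state (k : 'I_D) :
  (forall i j, bounded_measurable (fun u => state_after k u i j)) ->
  forall i j, bounded_measurable (fun u => rotated_state k u i j).
Proof.
move=> mS i j; rewrite /rotated_state.
have -> : (fun u => (umx (u k) *m state_after k u *m (umx (u k))^t*) i j) =
    (fun u => \sum_b (\sum_a umx (u k) i a * state_after k u a b) *
      (umx (u k) j b)^*).
  apply/funext => u; rewrite mxE; apply: eq_bigr => b _; rewrite !mxE.
  by [].
apply: bounded_measurable_sum => b; apply: bounded_measurableM.
  apply: bounded_measurable_sum => a; apply: bounded_measurableM => //.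
  exact: bounded_measurable_gate.
by apply: bounded_measurable_conj; exact: bounded_measurable_gate.
Qed.

Lemma bounded_measurable_state_after m : (m <= D)%N ->
  forall i j, bounded_measurable (fun u => state_after m u i j).
Proof.
move: m; apply: state_after_ind => [i j|k IH a b].
  have -> : (fun u => state_after 0 u i j) = (fun=> X0 i j).
    by apply/funext => u; rewrite state_after0.
  exact: bounded_measurable_cst.
have -> : (fun u => state_after k.+1 u a b) =
    (fun u => \sum_i \sum_j channel_entry Phi a b i j * rotated_state k u i j).
  by apply/funext => u; rewrite state_afterS tensor_channelE.
do 2 (apply: bounded_measurable_sum => ?); apply: bounded_measurableM.
  exact: bounded_measurable_cst.
exact: bounded_measurable_rotated_state.
Qed.

Context {d : measure_display} {T : measurableType d}.
Variables (P : probability T R) (U : 'I_D -> {RV P >-> borel_unitary R N}).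
Hypothesis haarU : forall k, is_haar (distribution P (U k)).
Hypothesis indepU : mutually_independent U.

Local Notation J := (joint_gates U).
Let mJ : measurable_fun setT J := measurable_joint_gates U.

Lemma bounded_measurable_comp (f : gate_tuple R N D -> C) :
  bounded_measurable f -> bounded_measurable (f \o J).
Proof.
move=> [f1 f2 [M Mf]]; split; last by exists M => x; exact: Mf.
- exact: (measurableT_comp f1 mJ).
- exact: (measurableT_comp f2 mJ).
Qed.

Local Notation rate := ((1 - gamma / 2)%:C%C : C).

Lemma layer_contraction (k : 'I_D) :
  cexpect P (fun x => frob2 (state_after k.+1 (J x))) <=
  rate ^+ n * cexpect P (fun x => frob2 (state_after k (J x))).
Proof.
pose Y x := rotated_state k (J x).
have mYu i j : bounded_measurable (fun u => rotated_state k u i j).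
  apply: bounded_measurable_rotated_state.
  by apply: bounded_measurable_state_after; exact: ltnW.
have mY i j : bounded_measurable (fun x => Y x i j).
  exact: (bounded_measurable_comp (mYu i j)).
have invY (V : 'M[C]_N) : V \is unitarymx -> forall i j a b,
    moment P Y i j a b = cexpect P (fun x =>
      (V *m Y x *m V^t*) i j * ((V *m Y x *m V^t*) a b)^*).
  move=> Vu i j a b; rewrite /moment /Y.
  rewrite (cexpect_translate haarU indepU k (Unitary Vu)
    (f := fun u => rotated_state k u i j * (rotated_state k u a b)^*)).
    by congr cexpect; apply/funext => x; rewrite rotated_state_translate.
  by apply: bounded_measurableM => //; exact: bounded_measurable_conj.
(* At least one qubit is present, which provides the two distinct indices needed by the twirl. *)
have N_gt1 : (1 < N)%N by rewrite qdimE -{1}(expn0 2) ltn_exp2l.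
pose p : 'I_N := Ordinal (ltnW N_gt1); pose q : 'I_N := Ordinal N_gt1.
have pq : p != q by [].
have trY x : \tr (Y x) = 0.
  by rewrite mxtrace_rotated_state mxtrace_state_after// ltnW.
set s := cexpect P (fun x => frob2 (state_after k (J x))).
have sE : cexpect P (fun x => frob2 (Y x)) = s.
  congr cexpect; apply/funext => x; rewrite frob2_conj//; exact: umx_unitary.
have s0 : 0 <= s by apply: cexpect_ge0 => x; exact: frob2_ge0.
pose h a b i j := channel_entry (n := n) Phi a b i j.
have -> : cexpect P (fun x => frob2 (state_after k.+1 (J x))) =
    s / (N%:R ^+ 2 - 1) * (\sum_a \sum_b \sum_i \sum_j h a b i j * (h a b i j)^*
      - frob2 (tensor_channel Phi (1%:M : 'M[C]_N)) / N%:R).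
  have mh a b : bounded_measurable (fun x => \sum_i \sum_j h a b i j * Y x i j).
    do 2 (apply: bounded_measurable_sum => ?); apply: bounded_measurableM => //.
    exact: bounded_measurable_cst.
  have mhh a b : bounded_measurable (fun x =>
      (\sum_i \sum_j h a b i j * Y x i j)
      * (\sum_i \sum_j h a b i j * Y x i j)^*).
    by apply: bounded_measurableM => //; exact: bounded_measurable_conj.
  transitivity (cexpect P (fun x => \sum_a \sum_b
      (\sum_i \sum_j h a b i j * Y x i j) *
      (\sum_i \sum_j h a b i j * Y x i j)^*)).
    congr cexpect; apply/funext => x; rewrite state_afterS.
    by apply: eq_bigr => a _; apply: eq_bigr => b _; rewrite tensor_channelE.
  rewrite cexpect_sum => [|a]; last exact: bounded_measurable_sum.
  rewrite /frob2 mulr_suml -sumrB mulr_sumr; apply: eq_bigr => a _.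
  rewrite cexpect_sum// mulr_suml -sumrB mulr_sumr; apply: eq_bigr => b _.
  by rewrite (cexpect_form mY invY pq)// sE -!sum_channel_entry_diag.
rewrite sum_channel_entry_sqr.
set f := \sum_x _; set G := frob2 _.
have f0 : 0 <= f by do 2 (apply: sumr_ge0 => ? _); exact: frob2_ge0.
have rate0 : 0 <= rate by rewrite ler0c; move: gamma01 => /andP[g0 g1]; lra.
have rate1 : rate <= 1.
  by rewrite -(rmorph1 (real_complex R)) lecR; move: gamma01 => /andP[g0 g1]; lra.
have fn : f ^+ n <= 4 ^+ n * rate ^+ n.
  by rewrite -exprMn; apply: lerXn2r; rewrite ?nnegrE ?mulr_ge0//;
    exact: replacement_frob2_le.
have N_gt0 : 0 < N%:R :> C by rewrite ltr0n ltnW.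
have NE : N%:R ^+ 2 = 4 ^+ n :> C by rewrite qdimE natrX -exprM mulnC exprM -natrX.
have GN : 1 <= G / N%:R.
  rewrite ler_pdivlMr// mul1r; apply: frob2_ge_trace.
  rewrite mxtrace_tensor_channel ?mxtrace1// => A; exact: mxtrace_replacement.
have N2 : 0 < N%:R ^+ 2 - 1 :> C by rewrite subr_gt0 exprn_egt1// ltr1n.
(* It remains to see [f ^+ n - G / N <= rate ^+ n * (4 ^+ n - 1)]: the first term is at most
   [4 ^+ n * rate ^+ n], and [rate ^+ n <= 1 <= G / N]. *)
rewrite mulrAC -mulrA mulrC ler_wpM2r//.
rewrite ler_pdivrMr// mulrBr mulr1 NE [_ * 4 ^+ n]mulrC.
apply: lerB => //; apply: le_trans GN; exact: exprn_ile1.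
Qed.

Lemma circuit_contraction m : (m <= D)%N ->
  cexpect P (fun x => frob2 (state_after m (J x))) <= rate ^+ (n * m) * frob2 X0.
Proof.
have rate0 : 0 <= rate by rewrite ler0c; move: gamma01 => /andP[g0 g1]; lra.
move: m; apply: state_after_ind => [|k IH].
  rewrite muln0 mul1r; under eq_fun do rewrite state_after0.
  by rewrite cexpect_cst.
apply: le_trans (layer_contraction k) _.
by rewrite mulnS exprD -mulrA ler_wpM2l// exprn_ge0.
Qed.

Lemma expect_trace_norm_le (t : R) : 0 < t ->
  ('E_P[fun w => trace_norm (noisy_circuit Phi [tuple umx (U k w) | k < D] X0)]
   <= ((N%:R * t + (1 - gamma / 2) ^+ (n * D) * complex.Re (frob2 X0) / t)
      / 2)%:E)%E.
Proof.
move=> t0; rewrite unlock.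
pose S x := state_after D (J x).
have SE w : noisy_circuit Phi [tuple umx (U k w) | k < D] X0 = S w.
  by rewrite /S /state_after take_oversize// size_map size_enum_ord.
have mS : bounded_measurable (fun x => frob2 (S x)).
  apply: bounded_measurable_frob2 => i j.
  exact: (bounded_measurable_comp (bounded_measurable_state_after (leqnn D) i j)).
(* [c] and [k] are the coefficients of the trace-norm bound, viewed as an affine function of the
   squared norm. *)
pose c := N%:R * t / 2; pose k := (t * 2)^-1.
pose g x : C := c%:C%C + k%:C%C * frob2 (S x).
have mkS : bounded_measurable (fun x => k%:C%C * frob2 (S x)).
  by apply: bounded_measurableM => //; exact: bounded_measurable_cst.
have mg : bounded_measurable g.
  by apply: bounded_measurableD => //; exact: bounded_measurable_cst.
have [ig _] := bounded_measurable_integrable P mg.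
have ReZ (a : R) (z : C) : complex.Re (a%:C%C * z) = a * complex.Re z.
  by case: z => x y; rewrite /= mul0r subr0.
apply: (@le_trans _ _ (\int[P]_x (complex.Re (g x))%:E)%E).
  apply: ge0_le_integral_nonmeasurable => x; rewrite lee_fin ?trace_norm_ge0// SE.
  apply: le_trans (trace_norm_le (S x) t0) _; rewrite le_eqVlt; apply/orP; left.
  by apply/eqP; rewrite /g raddfD /= ReZ /c /k; field; rewrite gt_eqF.
have -> : (\int[P]_x (complex.Re (g x))%:E = (complex.Re (cexpect P g))%:E)%E.
  by rewrite /= fineK//; exact: (integrable_fin_num measurableT ig).
rewrite /g cexpectD// ?cexpectZ//; last exact: bounded_measurable_cst.
rewrite cexpect_cst lee_fin.
have -> (z : C) : complex.Re (c%:C%C + k%:C%C * z) = c + k * complex.Re z.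
  by case: z => x y; rewrite /= mul0r subr0.
have := Re_le (circuit_contraction (leqnn D)).
have -> : rate ^+ (n * D) = ((1 - gamma / 2) ^+ (n * D))%:C%C by rewrite rmorphXn.
rewrite ReZ => H.
have -> : (N%:R * t + (1 - gamma / 2) ^+ (n * D) * complex.Re (frob2 X0) / t) / 2 =
    c + k * ((1 - gamma / 2) ^+ (n * D) * complex.Re (frob2 X0)).
  by rewrite /c /k; field; rewrite gt_eqF.
by rewrite lerD2l ler_wpM2l// /k invr_ge0 mulr_ge0// ltW.
Qed.

End Circuit.

(** * Tuning of the free parameter and the final estimate *)

Theorem theorem3 (R : realType) :
  exists K : R, \forall n \near \oo,
  forall (D : nat), (1 < D)%N ->
  forall (gamma : R), 0 < gamma <= 1 ->
  forall (sigma_star : 'M[R[i]]_2), is_density sigma_star ->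
  forall (d : measure_display) (T : measurableType d) (P : probability T R)
    (U : 'I_D -> {RV P >-> borel_unitary R (qdim n)}),
  (forall k, is_haar (distribution P (U k))) ->
  mutually_independent U ->
  forall (psi phi : 'cV[R[i]]_(qdim n)),
  is_unit_vector psi -> is_unit_vector phi -> psi^t* *m phi = 0 ->
  ((2^-1)%:E *
    'E_P[fun w => trace_norm
           (noisy_circuit (replacement_channel gamma sigma_star)
              [tuple umx (U k w) | k < D]
              (pure_state psi - pure_state phi))]
   <= (K * (2 `^ (n%:R / 2) *
            (1 - gamma / 2) `^ (n%:R * (D%:R - 1) / 2)))%:E)%E.
Proof.
(* The constant 1 works for every [n >= 1]; the argument yields [3 / 4]. *)
exists 1; exists 1%N => // n n1 D D1 gamma gamma01 sigma dsigma d T P U haarU indepU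
  psi phi upsi uphi psiphi.
have trX0 : \tr (pure_state psi - pure_state phi) = 0.
  by rewrite raddfB /= /pure_state !(mxtrace_mulC _ (_^t*)) upsi uphi subrr.
have phipsi : phi^t* *m psi = 0.
  by rewrite -[LHS]trmxCK adjoint_mul trmxCK psiphi trmx0 map_mx0.
(* Orthogonality kills the cross terms, and each projector contributes 1. *)
have frobX0 : frob2 (pure_state psi - pure_state phi) = 2.
  have pureJ (v : 'cV[R[i]]_(qdim n)) : (pure_state v)^t* = pure_state v.
    by rewrite /pure_state adjoint_mul trmxCK.
  rewrite frob2E raddfB /= map_mxB !pureJ mulmxBl !mulmxBr /pure_state.
  rewrite !mulmxA -!(mulmxA _ (_^t*)) upsi uphi psiphi phipsi.
  rewrite !mulmx1 !mulmx0 !mul0mx subr0 sub0r opprK mxtraceD.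
  by rewrite !(mxtrace_mulC _ (_^t*)) upsi uphi mxtrace1.
set r := 1 - gamma / 2.
have r0 : 0 < r by rewrite /r; move: gamma01 => /andP[g0 g1]; lra.
have r1 : r <= 1 by rewrite /r; move: gamma01 => /andP[g0 g1]; lra.
pose A : R := 2 `^ (n%:R / 2); pose B : R := r `^ (n%:R * (D%:R - 1) / 2).
have A0 : 0 < A by rewrite powR_gt0.
have B0 : 0 < B by rewrite powR_gt0.
have A2 : A ^+ 2 = (qdim n)%:R.
  rewrite -powR_mulrn ?ltW// -powRrM divfK// powR_mulrn// -natrX qdimE//.
(* All [D] layers contract, and [r <= 1] weakens the exponent [n * D] to the stated
   [n * (D - 1)]. *)
have B2 : r ^+ (n * D) <= B ^+ 2.
  rewrite -[B ^+ 2]powR_mulrn ?(ltW B0)// -powRrM divfK//.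
  rewrite -(natrB _ (ltnW D1)) -natrM powR_mulrn ?(ltW r0)//.
  by apply: ler_wiXn2l; rewrite ?(ltW r0)// leq_mul2l leq_subr orbT.
(* The choice [t = B / A] makes the dimension term equal to [A * B] and the contraction term at most
   [2 * (A * B)]; half their sum gives the factor [3 / 2]. *)
have := expect_trace_norm_le n1 gamma01 dsigma trX0 haarU indepU (divr_gt0 B0 A0).
rewrite frobX0 -/r -/A -/B => H.
apply: (@le_trans _ _ ((2^-1)%:E * ((3 / 2) * (A * B))%:E)%E).
  rewrite lee_wpmul2l// ?lee_fin//; apply: le_trans H _; rewrite lee_fin.
  rewrite -A2 (_ : complex.Re 2 = 2); last first.
    by rewrite -(rmorph_nat (real_complex R)).
  have -> : (A ^+ 2 * (B / A) + r ^+ (n * D) * 2 / (B / A)) / 2 =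
      A * B / 2 + r ^+ (n * D) / B * A by field; rewrite !gt_eqF.
  have : r ^+ (n * D) / B * A <= B * A by rewrite ler_pM2r// ler_pdivrMr// -expr2.
  by lra.
have AB0 := mulr_gt0 A0 B0.
by rewrite mul1r lee_fin; lra.
Qed.
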